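(* Let $A$ and $B$ be semisimple commutative Banach algebras with unit, and let $C$ be a semisimple Tomiyama product of $A$ and $B$. Suppose $C$ is a strong Ditkin algebra. Then $A$ and $B$ are strong Ditkin algebras.
   Context: Banach algebras are over $\mathbb{C}$. For commutative Banach algebras $A$ and $B$ with unit, a Tomiyama product of $A$ and $B$ is the completion of the algebraic tensor product $A\otimes B$ with respect to some submultiplicative cross norm (i.e. $\|a\otimes b\|=\|a\|\,\|b\|$) that is not less than the injective tensor product norm. For a commutative Banach algebra $D$ with unit, $M(D)$ is the set of nonzero multiplicative linear functionals $D\to\mathbb{C}$ with the relative weak-star topology from $D^*$, and $\hat a(\phi)=\phi(a)$. $D$ is semisimple if $a\mapsto\hat a$ is injective. The support $\mathrm{supp}(a)$ of $a\in D$ is the closure in $M(D)$ of $\{\phi\in M(D):\hat a(\phi)\ne0\}$. For $\phi\in M(D)$ put $I_\phi=\{a\in D:\hat a(\phi)=0\}$ and $J_\phi=\{a\in D:\phi\notin\mathrm{supp}(a)\}$. $D$ is a strong Ditkin algebra if for each $\phi\in M(D)$ the ideal $I_\phi$ has a bounded approximate identity contained in $J_\phi$, i.e. there exist $m_\phi>0$ and a sequence of elements $u_n\in J_\phi$ ($n\in\mathbb{N}$) such that $\|u_n\|\le m_\phi$ for each $n$ and $\|a-au_n\|\to0$ as $n\to\infty$ for each $a\in I_\phi$. *)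

(* Defs.v *)
From HB Require Import structures.
From mathcomp Require Import all_boot all_order all_algebra.
From mathcomp Require Import all_classical all_reals all_analysis.
From mathcomp Require Import complex.

Set Implicit Arguments.
Unset Strict Implicit.
Unset Printing Implicit Defensive.

Import Order.TTheory GRing.Theory Num.Theory.
Import numFieldNormedType.Exports.

Local Open Scope classical_set_scope.
Local Open Scope ring_scope.
Local Open Scope complex_scope.

(* A bundled record rather than a joined HB structure: a join of rings and
   normed modules would clash with the structure Num.NumDomain. The ring and
   algebra structures are recovered by the instances below. The unit is nonzero,
   but the normalization `|1| = 1 is not imposed. *)
Record comBanachAlgType (K : numFieldType) := ComBanachAlg {
  banach_space : completeNormedModType K;
  banach_one : banach_space;
  banach_mul : banach_space -> banach_space -> banach_space;
  banach_mulA : associative banach_mul;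
  banach_mulC : commutative banach_mul;
  banach_mul1 : left_id banach_one banach_mul;
  banach_mulDl : left_distributive banach_mul +%R;
  banach_scaleAl : forall (c : K) a b,
    c *: banach_mul a b = banach_mul (c *: a) b;
  banach_oner_neq0 : banach_one != 0;
  banach_normM : forall a b, `|banach_mul a b| <= `|a| * `|b|
}.

Definition banach_sort (K : numFieldType) (A : comBanachAlgType K) : Type :=
  banach_space A.
Coercion banach_sort : comBanachAlgType >-> Sortclass.

Section banach_instances.
Variables (K : numFieldType) (A : comBanachAlgType K).

HB.instance Definition _ :=
  CompleteNormedModule.copy (banach_sort A) (banach_space A).
HB.instance Definition _ := GRing.Zmodule_isComNzRing.Build (banach_sort A)
  (@banach_mulA K A) (@banach_mulC K A) (@banach_mul1 K A)
  (@banach_mulDl K A) (@banach_oner_neq0 K A).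
HB.instance Definition _ :=
  GRing.Lmodule_isLalgebra.Build K (banach_sort A) (@banach_scaleAl K A).
HB.instance Definition _ :=
  GRing.Lalgebra_isComAlgebra.Build K (banach_sort A).

End banach_instances.

(* The library norm of a module over R[i] takes its (nonnegative real) values
   in R[i]; [rnorm] is the same norm with values in R. *)
Definition rnorm (R : realType) (V : normedModType R[i]) (x : V) : R :=
  complex.Re `|x|.

Section spectrum.
Context {R : realType}.

(* Continuity is automatic for such functionals, so M(D) is a subset of D^*. *)
Record spectrum (D : comBanachAlgType R[i]) := Spectrum {
  spectrum_val :> {scalar D};
  spectrumM : forall a b, spectrum_val (a * b) = spectrum_val a * spectrum_val b;
  spectrum_neq0 : exists a, spectrum_val a != 0
}.

Definition gelfand (D : comBanachAlgType R[i]) (a : D) : spectrum D -> R[i]^o :=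
  fun phi => phi a.

Variable D : comBanachAlgType R[i].

Definition spectrum_eval (phi : spectrum D) : {ptws D -> R[i]^o} :=
  fun a => gelfand a phi.

HB.instance Definition _ := gen_eqMixin (spectrum D).
HB.instance Definition _ := gen_choiceMixin (spectrum D).
(* The weak-star topology is the coarsest one making all the evaluations
   continuous, i.e. the topology of pointwise convergence. *)
HB.instance Definition _ :=
  Topological.copy (spectrum D) (initial_topology spectrum_eval).

Definition semisimple : Prop := injective (@gelfand D).

Definition supp (a : D) : set (spectrum D) :=
  closure [set phi | gelfand a phi != 0].

Definition I_ideal (phi : spectrum D) : set D := [set a | gelfand a phi = 0].

Definition J_ideal (phi : spectrum D) : set D := [set a | ~ supp a phi].

Definition strong_ditkin : Prop :=
  forall phi : spectrum D, exists (m : R) (u : nat -> D),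
    [/\ 0 < m,
        forall n, J_ideal phi (u n),
        forall n, rnorm (u n) <= m
      & forall a, I_ideal phi a ->
          (rnorm (a - a * u n) @[n --> \oo] --> (0 : R))].

End spectrum.
Arguments semisimple {R} D.
Arguments strong_ditkin {R} D.

Section tomiyama.
Context {R : realType}.

(* [t] exhibits T as the algebraic tensor product of the algebras A and B. *)
Record is_tensor_product (A B T : comAlgType R[i])
    (t : {bilinear A -> B -> T}) : Prop := {
  tensor_universal : forall (W : lmodType R[i]) (f : {bilinear A -> B -> W}),
    exists g : {linear T -> W}, (forall a b, g (t a b) = f a b) /\
      forall h : {linear T -> W}, (forall a b, h (t a b) = f a b) -> h =1 g;
  tensorM : forall a a' b b', t a b * t a' b' = t (a * a') (b * b')
}.

Definition dual_ball (V : normedModType R[i]) : set {scalar V} :=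
  [set phi : {scalar V} | forall x, `|phi x| <= `|x|].

(* The functional g below is phi (x) psi, whose value at
   \sum_i t (a i) (b i) is \sum_i phi (a i) * psi (b i). *)
Definition injective_norm (A B : comBanachAlgType R[i]) (T : comAlgType R[i])
    (t : {bilinear A -> B -> T}) (x : T) : \bar R :=
  ereal_sup [set (rnorm (g x : R[i]^o))%:E | g in
    [set g : {scalar T} | exists2 phi : {scalar A}, dual_ball phi &
       exists2 psi : {scalar B}, dual_ball psi &
         forall a b, g (t a b) = phi a * psi b]].

Record is_submultiplicative_norm (T : comAlgType R[i]) (N : T -> R) : Prop := {
  alg_normD : forall x y, N (x + y) <= N x + N y;
  alg_normZ : forall (c : R[i]) x, N (c *: x) = rnorm (c : R[i]^o) * N x;
  alg_norm0_eq0 : forall x, N x = 0 -> x = 0;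
  alg_normM : forall x y, N (x * y) <= N x * N y
}.

Definition is_completion (T : comAlgType R[i]) (N : T -> R)
    (C : comBanachAlgType R[i]) (iota : {lrmorphism T -> C}) : Prop :=
  (forall x, rnorm (iota x) = N x) /\ dense (range iota).

Definition is_tomiyama_product (A B C : comBanachAlgType R[i]) : Prop :=
  exists (T : comAlgType R[i]) (t : {bilinear A -> B -> T}) (N : T -> R)
         (iota : {lrmorphism T -> C}),
    [/\ is_tensor_product t,
        is_submultiplicative_norm N,
        forall a b, N (t a b) = rnorm a * rnorm b,
        forall x, (injective_norm t x <= (N x)%:E)%E
      & is_completion N iota].

End tomiyama.

(* Main.v *)
Require Import Defs.
From HB Require Import structures.
From mathcomp Require Import all_boot all_order all_algebra.
From mathcomp Require Import all_classical all_reals all_analysis.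
From mathcomp Require Import complex.
From mathcomp Require Import ring lra.

(* By semisimplicity B has a character psi, and psi has norm at most 1. The
   slice map a (x) b |-> psi(b) a is an algebra homomorphism from A (x) B to A;
   by the Hahn-Banach theorem it is dominated by the injective norm, so it
   extends to a contractive homomorphism q : C -> A, which has a right inverse
   a |-> a (x) b0 where psi(b0) = 1. For a character phi of A, a bounded
   approximate identity (v_n) of the ideal of phi \o q yields the bounded
   approximate identity (q v_n) of the ideal of phi; the supports behave well
   because phi |-> phi \o q is continuous from M(A) to M(C). The case of B
   follows by symmetry. *)

Set Implicit Arguments.
Unset Strict Implicit.
Unset Printing Implicit Defensive.

Import Order.TTheory GRing.Theory Num.Theory.
Import numFieldNormedType.Exports.

Local Open Scope classical_set_scope.
Local Open Scope ring_scope.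
Local Open Scope complex_scope.

(** * The Hahn-Banach theorem *)

Section sublinear.
Context {R : realType} {V : lmodType R}.

(** Homogeneity is asked as an inequality, which is easier to check for infima; [sublinearZ]
    recovers the equality. *)
Record sublinear (p : V -> R) : Prop := Sublinear {
  sublinearD : forall x y, p (x + y) <= p x + p y;
  sublinearZ_le : forall (r : R) x, 0 <= r -> p (r *: x) <= r * p x
}.

Lemma sublinear0 p : sublinear p -> p 0 = 0.
Proof.
case=> pD pZ; apply/eqP; rewrite eq_le.
have := pD 0 0; have := pZ 0 0 (lexx _); rewrite scale0r addr0; lra.
Qed.

Lemma sublinearZ p r x : sublinear p -> 0 <= r -> p (r *: x) = r * p x.
Proof.
move=> pS; rewrite le_eqVlt => /predU1P[<-|r0].
  by rewrite scale0r sublinear0// mul0r.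
apply/eqP; rewrite eq_le sublinearZ_le ?(ltW r0)//=.
have := sublinearZ_le pS (r *: x) (ltW (_ : 0 < r^-1)).
rewrite invr_gt0 => /(_ r0); rewrite scalerA mulVf ?gt_eqF// scale1r.
by rewrite mulrC ler_pdivlMr// mulrC.
Qed.

Lemma sublinearN_ge p x : sublinear p -> - p (- x) <= p x.
Proof.
by move=> pS; have := sublinearD pS x (- x); rewrite subrr sublinear0//; lra.
Qed.

Lemma sublinearB_ge p x y : sublinear p -> p x - p (- y) <= p (x + y).
Proof.
move=> pS; have := sublinearD pS (x + y) (- y); rewrite addrK; lra.
Qed.

(** The auxiliary functional of the minimality proof of Hahn-Banach: for sublinear [p] it lies below
    [p], and at [- y] it is at most [- p y]. *)
Definition sublinear_shift (p : V -> R) (y x : V) : R :=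
  inf [set p (x + t *: y) - t * p y | t in [set t : R | 0 <= t]].

(** Subadditivity gives [p (t *: y) <= p (x + t *: y) + p (- x)]. Hence the infimum is a genuine one
    and not a default value. *)
Let shift_lb p y x : sublinear p ->
  lbound [set p (x + t *: y) - t * p y | t in [set t : R | 0 <= t]] (- p (- x)).
Proof.
move=> pS _ [t t0 <-]; rewrite -(sublinearZ _ pS t0).
have := sublinearB_ge (t *: y) x pS; rewrite (addrC (t *: y)); lra.
Qed.

Let shift_nonempty (p : V -> R) y x :
  [set p (x + t *: y) - t * p y | t in [set t : R | 0 <= t]] !=set0.
Proof. by exists (p (x + 0 *: y) - 0 * p y), 0 => //=. Qed.

Lemma sublinear_shift_le p x y t : sublinear p -> 0 <= t ->
  sublinear_shift p y x <= p (x + t *: y) - t * p y.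
Proof.
move=> pS t0; apply: ge_inf; last by exists t.
by exists (- p (- x)); exact: shift_lb.
Qed.

Lemma sublinear_shift_le_self p y x : sublinear p ->
  sublinear_shift p y x <= p x.
Proof.
move=> pS; have := sublinear_shift_le x y pS (lexx 0).
by rewrite scale0r addr0 mul0r subr0.
Qed.

(** Parameters [t1] at [x1] and [t2] at [x2] yield [t1 + t2] at the sum; a parameter [t] at [x]
    yields [r * t] at [r *: x]. *)
Lemma sublinear_sublinear_shift p y : sublinear p ->
  sublinear (sublinear_shift p y).
Proof.
move=> pS; split=> [x1 x2|r x r0].
  rewrite -lerBlDr; apply: (lb_le_inf (shift_nonempty _ _ _)) => _ [t1 t10 <-].
  rewrite lerBlDr -lerBlDl.
  apply: (lb_le_inf (shift_nonempty _ _ _)) => _ [t2 t20 <-].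
  have := sublinear_shift_le (x1 + x2) y pS (addr_ge0 t10 t20).
  have := sublinearD pS (x1 + t1 *: y) (x2 + t2 *: y).
  rewrite scalerDl addrACA mulrDl; lra.
move: r0; rewrite le_eqVlt => /predU1P[<-|r0].
  rewrite scale0r mul0r.
  have := sublinear_shift_le 0 y pS (lexx 0).
  by rewrite scale0r addr0 mul0r subr0 (sublinear0 pS).
rewrite -ler_pdivrMl//.
apply: (lb_le_inf (shift_nonempty _ _ _)) => _ [t t0 <-].
rewrite ler_pdivrMl//.
have := sublinear_shift_le (r *: x) y pS (mulr_ge0 (ltW r0) t0).
by rewrite -scalerA -scalerDr (sublinearZ _ pS (ltW r0)) mulrBr mulrA.
Qed.

(** The pointwise infimum works. For subadditivity, take [q1] at [x] and [q2] at [y]: the smaller of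
    the two, used at both points, bounds the infimum at [x + y]. *)
Lemma sublinear_chain_inf (p : V -> R) (F : set (V -> R)) :
  F !=set0 -> (forall q, F q -> sublinear q /\ forall x, q x <= p x) ->
  (forall q1 q2, F q1 -> F q2 ->
    (forall x, q1 x <= q2 x) \/ (forall x, q2 x <= q1 x)) ->
  exists q, [/\ sublinear q, forall x, q x <= p x
              & forall q', F q' -> forall x, q x <= q' x].
Proof.
move=> [q0 Fq0] Fp Ftot.
pose q x := inf [set q' x | q' in F].
have qle q' x : F q' -> q x <= q' x.
  move=> Fq'; apply: ge_inf; last by exists q'.
  exists (- p (- x)) => _ [q1 Fq1 <-]; have [q1S q1p] := Fp _ Fq1.
  have := sublinearN_ge x q1S; have := q1p (- x); lra.
have le_q z x : (forall q', F q' -> z <= q' x) -> z <= q x.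
  move=> zle; apply: lb_le_inf; first by exists (q0 x), q0.
  by move=> _ [q' Fq' <-]; exact: zle.
exists q; split; last by move=> q' Fq' x; exact: qle.
- split=> [x y|r x].
    rewrite -lerBlDr; apply: (le_q) => q1 Fq1.
    rewrite lerBlDr -lerBlDl; apply: (le_q) => q2 Fq2.
    rewrite lerBlDl.
    have [q1S _] := Fp _ Fq1; have [q2S _] := Fp _ Fq2.
    have [q12|q21] := Ftot _ _ Fq1 Fq2.
      have := qle _ (x + y) Fq1; have := sublinearD q1S x y; have := q12 y; lra.
    have := qle _ (x + y) Fq2; have := sublinearD q2S x y; have := q21 x; lra.
  rewrite le_eqVlt => /predU1P[<-|r0].
    have [q0S _] := Fp _ Fq0.
    by rewrite scale0r mul0r -(sublinear0 q0S); exact: qle.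
  rewrite -ler_pdivrMl//; apply: (le_q) => q' Fq'; rewrite ler_pdivrMl//.
  have [q'S _] := Fp _ Fq'.
  by rewrite -(sublinearZ _ q'S (ltW r0)); exact: qle.
- by move=> x; apply: le_trans (qle _ x Fq0) _; have [] := Fp _ Fq0.
Qed.

Lemma sublinear_minimal (p : V -> R) : sublinear p ->
  exists q, [/\ sublinear q, forall x, q x <= p x
    & forall q', sublinear q' -> (forall x, q' x <= q x) -> q' = q].
Proof.
move=> pS.
pose T := {q : V -> R | sublinear q /\ forall x, q x <= p x}.
(* The order is reversed, so that Zorn's lemma yields a minimal functional. *)
pose ge_fun (q1 q2 : T) := `[< forall x, sval q2 x <= sval q1 x >].
pose p0 : T := exist _ p (conj pS (fun x => lexx (p x))).
have [| |F Ftot|[q [qS qp]] qmin] := @ZL_preorder T p0 ge_fun.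
- by move=> q; apply/asboolP.
- move=> q1 q2 q3 /asboolP q12 /asboolP q23; apply/asboolP => x.
  exact: le_trans (q23 x) (q12 x).
- have [F0|/set0P[q0 Fq0]] := eqVneq F set0.
    by exists p0 => q; rewrite F0.
  have [||_ _ [q1 Fq1 <-] [q2 Fq2 <-]|q [qS qp qF]] :=
      @sublinear_chain_inf p [set sval q | q in F].
  - by exists (sval q0), q0.
  - by move=> _ [q _ <-]; exact: (svalP q).
  - by have [/asboolP|/asboolP] := Ftot _ _ Fq1 Fq2; [right|left].
  by exists (exist _ q (conj qS qp)) => q' Fq'; apply/asboolP/qF; exists q'.
exists q; split=> // q' q'S q'q.
have q'p x : q' x <= p x := le_trans (q'q x) (qp x).
have /asboolP qq' := qmin (exist _ q' (conj q'S q'p)) (asboolT q'q).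
by apply/funext => x; apply/eqP; rewrite eq_le q'q qq'.
Qed.

(* A minimal sublinear functional [q] coincides with all its shifts, so
   [q x + q y <= q (x + y)]. Starting from the shift of [p] at [a] forces the
   value [p a] at [a]. *)
Theorem hahn_banach_sublinear (p : V -> R) (a : V) : sublinear p ->
  exists f : {scalar V}, (forall x, f x <= p x) /\ f a = p a.
Proof.
move=> pS; have [q [qS qpa qmin]] :=
  sublinear_minimal (sublinear_sublinear_shift a pS).
have qp x : q x <= p x.
  exact: le_trans (qpa x) (sublinear_shift_le_self a x pS).
have qD x y : q (x + y) = q x + q y.
  apply/eqP; rewrite eq_le sublinearD//=.
  have qE := qmin _ (sublinear_sublinear_shift y qS)
    (fun z => sublinear_shift_le_self y z qS).
  have := sublinear_shift_le x y qS ler01; rewrite qE scale1r; lra.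
have q0 := sublinear0 qS.
have qN x : q (- x) = - q x.
  by apply/eqP; rewrite -addr_eq0 -qD addNr q0.
have qZ r x : q (r *: x) = r * q x.
  have [r0|r0] := leP 0 r; first exact: sublinearZ.
  rewrite -[r]opprK scaleNr qN mulNr.
  by rewrite sublinearZ// oppr_ge0 ltW.
have qlin : scalar q by move=> r x y; rewrite qD qZ.
pose qL := GRing.isLinear.Build R V R *%R q qlin.
pose f : {scalar V} := HB.pack q qL.
exists f; split => //=; apply/eqP; rewrite eq_le qp/= -lerN2 -qN.
(* At [- a] the parameter 1 bounds the shift by [p 0 - p a = - p a]. *)
apply: le_trans (qpa _) _; have := sublinear_shift_le (- a) a pS ler01.
by rewrite scale1r addNr sublinear0//; lra.
Qed.
End sublinear.

(** * The norm with real values *)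

Section rnorm.
Context {R : realType} {V : normedModType R[i]}.
Implicit Types (x y : V) (c : R[i]).

Lemma rnormE x : `|x| = (rnorm x)%:C.
Proof. by rewrite /rnorm RRe_real ?normr_real. Qed.

Lemma rnorm_ge0 x : 0 <= rnorm x.
Proof. by rewrite -ler0c -rnormE. Qed.

Lemma rnormD x y : rnorm (x + y) <= rnorm x + rnorm y.
Proof. by have := ler_normD x y; rewrite !rnormE -rmorphD lecR. Qed.

Lemma rnormZ c x : rnorm (c *: x) = rnorm (c : R[i]^o) * rnorm x.
Proof. by apply: complexI; have := normrZ c x; rewrite !rnormE -rmorphM. Qed.

Lemma rnorm0 : rnorm (0 : V) = 0.
Proof. by rewrite /rnorm normr0. Qed.

Lemma rnorm_le0 x : (rnorm x <= 0) = (x == 0).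
Proof. by rewrite -lecR -rnormE normr_le0. Qed.

Lemma rnormN x : rnorm (- x) = rnorm x.
Proof. by rewrite /rnorm normrN. Qed.

Lemma rnormB x y : rnorm (x - y) = rnorm (y - x).
Proof. by rewrite /rnorm distrC. Qed.

Lemma rnormB_tri x y z : rnorm (x - z) <= rnorm (x - y) + rnorm (y - z).
Proof. by rewrite (_ : x - z = (x - y) + (y - z)) ?rnormD// addrA subrK. Qed.

End rnorm.

Section rnormC.
Context {R : realType}.
Implicit Types (z : R[i]).

Lemma rnorm_real (r : R) : rnorm (r%:C : R[i]^o) = `|r|.
Proof.
by apply: complexI; rewrite -rnormE normc_def/= expr0n/= addr0 sqrtr_sqr.
Qed.

Lemma rnormV z : rnorm (z^-1 : R[i]^o) = (rnorm (z : R[i]^o))^-1.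
Proof. by apply: complexI; rewrite fmorphV -!rnormE normfV. Qed.

Lemma Re_le_rnorm z : complex.Re z <= rnorm (z : R[i]^o).
Proof.
apply: le_trans (ler_norm _) _; rewrite -lecR -rnormE; exact: normc_ge_Re.
Qed.

(** Serves to turn a bound on the real part of a linear functional into a bound on its modulus. *)
Lemma rnorm_phase z : exists2 c : R[i],
  rnorm (c : R[i]^o) = 1 & c * z = (rnorm (z : R[i]^o))%:C.
Proof.
have [->|z0] := eqVneq z 0.
  by exists 1; rewrite ?mulr0 ?rnorm0// /rnorm normr1.
exists (`|z| / z); last by rewrite divfK// rnormE.
by rewrite /rnorm normf_div normr_id divff// normr_eq0.
Qed.

End rnormC.

(** * Restriction of scalars and the complex Hahn-Banach theorem *)

Section realify.
Context {R : realType}.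

(** A synonym that keeps the module structure over [R] apart from the one over [R[i]]. *)
Definition realify (V : lmodType R[i]) : Type := V.

Variable V : lmodType R[i].

HB.instance Definition _ := GRing.Zmodule.copy (realify V) V.

Let rscale (r : R) (v : realify V) : realify V := (r%:C : R[i]) *: (v : V).

Let rscaleA r s v : rscale r (rscale s v) = rscale (r * s) v.
Proof. by rewrite /rscale scalerA rmorphM. Qed.

Let rscale1 : left_id 1 rscale.
Proof. by move=> v; rewrite /rscale rmorph1 scale1r. Qed.

Let rscaleDr : right_distributive rscale +%R.
Proof. by move=> r u v; rewrite /rscale scalerDr. Qed.

Let rscaleDl v : {morph rscale^~ v : r s / r + s}.
Proof. by move=> r s; rewrite /rscale rmorphD scalerDl. Qed.

HB.instance Definition _ := GRing.Zmodule_isLmodule.Build R (realify V)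
  rscaleA rscale1 rscaleDr rscaleDl.

Lemma realify_scale (r : R) (v : realify V) : r *: v = r%:C *: (v : V).
Proof. by []. Qed.

End realify.

Section complex_hahn_banach.
Context {R : realType} {V : normedModType R[i]}.

(** The real theorem, applied to the norm, gives a real functional [u] with [u a] equal to the norm
    of [a]; then [u x - i u (i x)] is complex linear with real part [u]. *)
Theorem hahn_banach_norm (a : V) :
  exists2 f : {scalar V}, dual_ball f & rnorm a <= rnorm (f a : R[i]^o).
Proof.
have nS : sublinear (fun x : realify V => rnorm (x : V)).
  split=> [x y|r x r0]; first exact: rnormD.
  by rewrite realify_scale rnormZ rnorm_real ger0_norm.
have [u [uN ua]] := hahn_banach_sublinear (a : realify V) nS.
have uZ (r : R) (x : V) : u (r%:C *: x) = r * u x by exact: (linearZ_LR u).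
have uD (x y : V) : u (x + y) = u x + u y by exact: (raddfD u).
have uB (x : V) : u (- x) = - u x by exact: (raddfN u).
pose f (x : V) : R[i] := u x +i* - u ('i%C *: x).
have flin : scalar f.
  move=> c x y; rewrite /f scalerDr !uD scalerA.
  have -> : 'i%C * c = (- complex.Im c)%:C + (complex.Re c)%:C * 'i%C :> R[i].
    by case: c => p q; apply/eqP; rewrite eq_complex/=; apply/andP; split;
      apply/eqP; ring.
  have -> : c *: x = (complex.Re c)%:C *: x + (complex.Im c)%:C *: ('i%C *: x).
    by rewrite {1}[c]complexE scalerDl scalerA mulrC.
  rewrite scalerDl -scalerA !uD !uZ.
  by case: c => p q; apply/eqP; rewrite eq_complex/=; apply/andP; split;
      apply/eqP; ring.
pose fL := GRing.isLinear.Build R[i] V R[i] *%R f flin.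
pose g : {scalar V} := HB.pack f fL.
exists g; last by rewrite -ua; exact: (Re_le_rnorm (f a)).
(* A unit phase makes the value real, hence equal to [u (c *: x)], which is at most the norm of
   [x]. *)
move=> x; have [c c1 cz] := rnorm_phase (g x).
rewrite (rnormE (g x : R[i]^o)) rnormE lecR.
have -> : rnorm (g x : R[i]^o) = u (c *: x).
  have : g (c *: x) = c * g x by exact: (linearZ_LR g).
  by rewrite cz => /(congr1 (@complex.Re R)) /= ->.
by apply: le_trans (uN _) _; rewrite rnormZ c1 mul1r.
Qed.

End complex_hahn_banach.

(** * Banach algebras and their characters *)

Section rnorm_complete.
Context {R : realType}.

Lemma le_addM_cvg0 (e : nat -> R) (z w k : R) : e @ \oo --> 0 ->
  (forall n, z <= w + k * e n) -> z <= w.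
Proof.
move=> e0 zle; have wk : (w + k * e n @[n --> \oo]) --> w.
  rewrite -[X in _ --> X]addr0 -(mulr0 k); apply: cvgD; first exact: cvg_cst.
  by apply: cvgM => //; exact: cvg_cst.
by apply: (cvgr_to_ge wk); exact: nearW.
Qed.

(** The bound [e n] controls the whole tail from [n] on, so it gives the Cauchy property and
    survives in the limit. *)
Lemma rnorm_cauchy_lim (V : completeNormedModType R[i]) (u : nat -> V)
    (e : nat -> R) :
  e @ \oo --> 0 -> (forall n k, rnorm (u (n + k)%N - u n) <= e n) ->
  exists l, forall n, rnorm (l - u n) <= e n.
Proof.
move=> e0 ue.
have /cauchy_cvg ul : cauchy (u @ \oo).
  apply: cauchy_exP => eps eps0.
  have [r r0 ->] : exists2 r : R, 0 < r & eps = r%:C.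
    exists (complex.Re eps); first by move: eps0; rewrite ltcE => /andP[].
    by rewrite RRe_real// gtr0_real.
  have /cvgrPdist_lt /(_ _ r0) [N _ Ne] := e0.
  exists (u N); exists N => // n /= Nn; rewrite -ball_normE/= rnormE ltcR.
  rewrite rnormB -(subnKC Nn); apply: le_lt_trans (ue _ _) _.
  have := Ne N (leqnn N); rewrite /= sub0r normrN.
  exact/le_lt_trans/ler_norm.
exists (lim (u @ \oo)) => n; apply/ler_addgt0Pr => r r0.
have /cvgrPdist_lt /(_ r%:C) := ul; rewrite ltcR => /(_ r0) [N _ uN].
have /= := uN (maxn n N) (leq_maxr n N); rewrite rnormE ltcR => lN.
apply: le_trans (rnormB_tri _ (u (maxn n N)) _) _.
have := ue n (maxn n N - n)%N; rewrite subnKC ?leq_maxl//; lra.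
Qed.

Lemma dense_rnorm (V : normedModType R[i]) (S : set V) (c : V) (d : R) :
  dense S -> 0 < d -> exists2 x, S x & rnorm (c - x) < d.
Proof.
move=> dS d0; have [] := dS (ball c d%:C).
- by exists c; apply: ballxx; rewrite ltcR.
- exact: ball_open.
move=> x [+ Sx]; rewrite -ball_normE/= rnormE ltcR => cx.
by exists x.
Qed.

End rnorm_complete.

Section banach.
Context {R : realType} {A : comBanachAlgType R[i]}.
Implicit Types a b : A.

Lemma rnormM a b : rnorm (a * b) <= rnorm a * rnorm b.
Proof. by have := banach_normM a b; rewrite !rnormE -rmorphM lecR. Qed.

(** The solution is the sum of the powers of [b] from the first on, reached by iterating
    [z |-> b + b * z] from 0. Starting the series at [b] keeps out the norm of 1, which is not
    normalized. *)
Lemma neumann b : rnorm b < 1 -> exists y : A, y = b + b * y.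
Proof.
move=> b1; pose y n := iter n (fun z => b + b * z) 0.
have yb n : rnorm (y n) <= (1 - rnorm b)^-1.
  elim: n => [|n IH]; first by rewrite rnorm0 invr_ge0 subr_ge0 ltW.
  rewrite /y iterS -/(y n); apply: le_trans (rnormD _ _) _.
  have /(ler_wpM2l (rnorm_ge0 b)) := IH.
  have : (1 - rnorm b) * (1 - rnorm b)^-1 = 1.
    by rewrite divff// subr_eq0 gt_eqF.
  have := rnormM b (y n); lra.
have yB n k : rnorm (y (n + k)%N - y n) <= (1 - rnorm b)^-1 * rnorm b ^+ n.
  elim: n => [|n IH]; first by rewrite add0n subr0 expr0 mulr1.
  rewrite addSn /y !iterS -/(y n) -/(y (n + k)%N).
  rewrite opprD addrACA subrr add0r -mulrBr; apply: le_trans (rnormM _ _) _.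
  by rewrite exprS mulrCA ler_wpM2l ?rnorm_ge0.
have e0 : (fun n => (1 - rnorm b)^-1 * rnorm b ^+ n) @ \oo --> (0 : R).
  by apply: cvg_geometric; rewrite ger0_norm ?rnorm_ge0.
have [l ly] := rnorm_cauchy_lim e0 yB.
exists l; apply/eqP; rewrite -subr_eq0 -rnorm_le0.
(* One error for replacing [l] by [y n.+1], one for replacing [b * y n] by [b * l]. *)
apply: (le_addM_cvg0 (k := 2) e0) => n; rewrite add0r.
apply: le_trans (rnormB_tri _ (y n.+1) _) _.
have -> : y n.+1 - (b + b * l) = b * (y n - l).
  by rewrite /y iterS -/(y n) opprD addrACA subrr add0r mulrBr.
have := ly n.+1; have := rnormM b (y n - l); rewrite (rnormB (y n)).
have := ler_wpM2l (rnorm_ge0 b) (ly n); rewrite exprS mulrCA.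
have e_ge0 : 0 <= (1 - rnorm b)^-1 * rnorm b ^+ n.
  by rewrite mulr_ge0 ?exprn_ge0 ?rnorm_ge0// invr_ge0 subr_ge0 ltW.
have := ler_wpM2r e_ge0 (ltW b1); rewrite mul1r; lra.
Qed.

(** If [psi a] exceeded the norm of [a], then [b = a / psi a] would have norm below 1 and
    [psi b = 1]. Applying [psi] to the solution of [y = b + b * y] gives [psi y = 1 + psi y]. *)
Lemma spectrum_dual_ball (psi : spectrum A) : dual_ball psi.
Proof.
move=> a; rewrite (rnormE (psi a : R[i]^o)) rnormE lecR leNgt; apply/negP => na.
pose b := (psi a)^-1 *: a.
have psia : psi a != 0.
  apply: contraTneq na => ->; by rewrite rnorm0 -leNgt rnorm_ge0.
have [|y yE] := @neumann b.
  rewrite rnormZ rnormV.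
  by rewrite mulrC ltr_pdivrMr ?mul1r// (le_lt_trans _ na)// rnorm_ge0.
have psib : psi b = 1 by rewrite [LHS](linearZ_LR psi)/= mulVf.
have psiy : psi (b + b * y) = 1 + psi y.
  rewrite [LHS](raddfD psi)/= psib; congr (1 + _).
  by rewrite [LHS](spectrumM psi) psib mul1r.
move: psiy; rewrite -yE => /eqP.
by rewrite -[X in X == _]add0r (inj_eq (addIr _)) eq_sym oner_eq0.
Qed.

End banach.

Section spectrum_continuity.
Context {R : realType}.

Lemma gelfand_continuous (D : comBanachAlgType R[i]) (a : D) :
  continuous (gelfand a : spectrum D -> R[i]^o).
Proof.
move=> phi.
have evalP : continuous (@spectrum_eval R D).
  exact: (@initial_continuous _ _ (@spectrum_eval R D)).
apply: (@continuous_comp _ _ _ (@spectrum_eval R D) (proj a)).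
  exact: evalP.
exact: proj_continuous.
Qed.

Lemma spectrum_continuous (X : topologicalType) (D : comBanachAlgType R[i])
    (f : X -> spectrum D) :
  (forall a, continuous (fun x => gelfand a (f x))) -> continuous f.
Proof.
move=> fa; apply: continuous_comp_initial => x.
by apply/pointwise_cvgP => a; exact: fa.
Qed.

End spectrum_continuity.

(** * Strong Ditkin algebras and contractive retractions *)

Section retract.
Context {R : realType} {A C : comBanachAlgType R[i]}.
Variables (q : {linear C -> A}) (j : A -> C).
Hypotheses (qM : forall c d, q (c * d) = q c * q d) (jK : cancel j q).
Hypothesis q_le : forall c, rnorm (q c) <= rnorm c.

Let comap_lin (phi : spectrum A) : scalar (phi \o q).
Proof. by move=> k x y; rewrite /= linearP [LHS](linearP phi). Qed.

Let comap_scalar (phi : spectrum A) : {scalar C} :=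
  HB.pack (phi \o q) (GRing.isLinear.Build R[i] C R[i] *%R _ (comap_lin phi)).

Let comap_neq0 (phi : spectrum A) : exists c, comap_scalar phi c != 0.
Proof. by have [a a0] := spectrum_neq0 phi; exists (j a); rewrite /= jK. Qed.

Let comapM (phi : spectrum A) c d :
  comap_scalar phi (c * d) = comap_scalar phi c * comap_scalar phi d.
Proof. by rewrite /= qM spectrumM. Qed.

Let comap (phi : spectrum A) : spectrum C :=
  Spectrum (comapM phi) (comap_neq0 phi).

Let comap_continuous : continuous comap.
Proof.
by apply: spectrum_continuous => c; exact: (@gelfand_continuous _ A (q c)).
Qed.

Lemma strong_ditkin_retract : strong_ditkin C -> strong_ditkin A.
Proof.
move=> ditC phi; have [m [v [m0 vJ vm vI]]] := ditC (comap phi).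
exists m, (q \o v); split=> //.
- move=> n /=; have : ~ supp (v n) (comap phi) by exact: vJ.
  (* A neighbourhood of [comap phi] pulls back to one of [phi], which contains some [psi] with
     [psi (q (v n))] nonzero; [comap psi] is then the required point. *)
  apply: contra_not => phi_supp U /comap_continuous /phi_supp.
  move=> [/= psi [psi0 Upsi]].
  by exists (comap psi).
- by move=> n; exact: le_trans (q_le _) (vm n).
- move=> a phia; have /vI jav : I_ideal (comap phi) (j a).
    by rewrite /I_ideal/= /gelfand/= jK.
  (* Here [a - a * q (v n)] is the image under [q] of [j a - j a * v n]. *)
  apply: (squeeze_cvgr _ (cvg_cst 0) jav); apply: nearW => n.
  rewrite rnorm_ge0/=; apply: le_trans (q_le _).
  by rewrite raddfB/= qM jK.
Qed.

End retract.

(** * Extending a contractive homomorphism to the completion *)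

Section extension.
Context {R : realType} {T : comAlgType R[i]} {A C : comBanachAlgType R[i]}.
Variables (iota : {lrmorphism T -> C}) (p : {linear T -> A}).
Hypotheses (iota_dense : dense (range iota)).
Hypothesis pM : forall x y, p (x * y) = p x * p y.
Hypothesis p_le : forall x, rnorm (p x) <= rnorm (iota x).

Let approx (c : C) (d : R) : 0 < d -> exists x, rnorm (c - iota x) < d.
Proof. by move=> /(dense_rnorm c iota_dense)[_ [x _ <-]]; exists x. Qed.

(** The value is the limit of [p (x n)] for [iota (x n)] tending to [c]. An inequality against every
    [x] determines it and replaces limits in the sequel. *)
Let value c : exists a, forall x, rnorm (a - p x) <= rnorm (c - iota x).
Proof.
have /choice[x xc] (n : nat) : exists x, rnorm (c - iota x) < harmonic n :> R.
  exact/approx/harmonic_gt0.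
(* From index [n] on, every [iota (x k)] is within [harmonic n] of [c], so any two are within twice
   that. *)
pose e n : R := 2 * harmonic n.
have e0 : e @ \oo --> 0.
  rewrite -(mulr0 2); apply: cvgM; [exact: cvg_cst | exact: cvg_harmonic].
have pe n k : rnorm (p (x (n + k)%N) - p (x n)) <= e n.
  rewrite -raddfB/=; apply: le_trans (p_le _) _; rewrite raddfB/=.
  apply: le_trans (rnormB_tri _ c _) _; rewrite rnormB /e mulr_natl mulr2n.
  apply: lerD (ltW (xc n)); apply: le_trans (ltW (xc _)) _.
  by rewrite lef_pV2 ?posrE// ler_nat ltnS leq_addr.
have [l lp] : exists l : A, forall n, rnorm (l - p (x n)) <= e n.
  exact: rnorm_cauchy_lim e0 pe.
(* The errors add up to [3 * harmonic n], less than [2 * e n]. *)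
exists l => y; apply: (le_addM_cvg0 (k := 2) e0) => n.
have h1 : rnorm (l - p (x n)) <= e n by exact: lp.
have h2 : rnorm (p (x n) - p y) <= rnorm (iota (x n) - iota y).
  by have := p_le (x n - y); rewrite !raddfB.
have h3 : rnorm (l - p y) <= rnorm (l - p (x n)) + rnorm (p (x n) - p y).
  exact: rnormB_tri.
have h4 : rnorm (iota (x n) - iota y) <=
    rnorm (c - iota (x n)) + rnorm (c - iota y).
  by rewrite (rnormB c (iota (x n))); exact: rnormB_tri.
have h5 : rnorm (c - iota (x n)) < harmonic n by exact: xc.
have h6 : 0 < harmonic n :> R by exact: harmonic_gt0.
apply: le_trans h3 _; rewrite /e in h1 *; lra.
Qed.

Theorem contraction_extension : exists q : {linear C -> A},
  [/\ forall x, q (iota x) = p x, forall c d, q (c * d) = q c * q d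
    & forall c, rnorm (q c) <= rnorm c].
Proof.
have /choice[q qp] := value.
(* Identities for [q] are proved up to a multiple of an arbitrarily small [d]; [d <= 1] keeps the
   approximants bounded in the estimate for products. *)
have q0 a k : (forall d : R, 0 < d -> d <= 1 -> rnorm a <= k * d) -> a = 0 :> A.
  move=> ak; apply/eqP; rewrite -rnorm_le0.
  apply: (le_addM_cvg0 (k := k) cvg_harmonic) => n.
  by rewrite add0r; apply: ak; rewrite ?invr_gt0// invf_le1// ler1n.
have q_le c : rnorm (q c) <= rnorm c.
  by have := qp c 0; rewrite (raddf0 p) (raddf0 iota) !subr0.
have qlin : linear q.
  move=> s c d; apply/eqP; rewrite -subr_eq0; apply/eqP.
  (* The factor 2 counts two comparisons with [p (s *: x + y)], one made in [C] through [qp] and one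
     made in [A]. *)
  apply: (q0 _ (2 * (rnorm (s : R[i]^o) + 1))) => r r0 _.
  have [x xc] := approx c r0; have [y yd] := approx d r0.
  have iotaE :
      s *: c + d - iota (s *: x + y) = s *: (c - iota x) + (d - iota y).
    by rewrite linearP opprD addrACA scalerBr.
  have pE : p (s *: x + y) - (s *: q c + q d) = s *: (p x - q c) + (p y - q d).
    by rewrite linearP opprD addrACA scalerBr.
  have [qc qd] : rnorm (p x - q c) <= r /\ rnorm (p y - q d) <= r.
    by rewrite !(rnormB (p _)); split; apply: le_trans (qp _ _) (ltW _).
  have s0 := rnorm_ge0 (s : R[i]^o).
  have le_r (V : normedModType R[i]) (a b : V) : rnorm a <= r -> rnorm b <= r ->
      rnorm (s *: a + b) <= (rnorm (s : R[i]^o) + 1) * r.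
    move=> ar br; apply: le_trans (rnormD _ _) _.
    by rewrite rnormZ mulrDl mul1r lerD// ler_wpM2l.
  apply: le_trans (rnormB_tri _ (p (s *: x + y)) _) _.
  rewrite -mulrA mulr_natl mulr2n lerD//; last by rewrite pE; exact: le_r.
  by apply: le_trans (qp _ _) _; rewrite iotaE le_r// ltW.
have qM c d : q (c * d) = q c * q d.
  apply/eqP; rewrite -subr_eq0; apply/eqP.
  apply: (q0 _ (2 * (rnorm c + rnorm d + 1))) => r r0 r1.
  have [x xc] := approx c r0; have [y yd] := approx d r0.
  (* Stated for any [D], since it is used both in [C] and in [A]. *)
  have mulB (D : comBanachAlgType R[i]) (a b a' b' : D) :
      rnorm (a - a') <= r -> rnorm (b - b') <= r -> rnorm a <= rnorm c ->
      rnorm b <= rnorm d ->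
      rnorm (a * b - a' * b') <= (rnorm c + rnorm d + 1) * r.
    move=> aa' bb' ac bd.
    have -> : a * b - a' * b' = a * (b - b') + (a - a') * b'.
      by rewrite mulrBr mulrBl addrA subrK.
    apply: le_trans (rnormD _ _) _.
    have h1 := le_trans (rnormM a (b - b'))
      (ler_pM (rnorm_ge0 _) (rnorm_ge0 _) ac bb').
    have h2 : rnorm b' <= rnorm d + 1.
      rewrite -[b'](subKr b).
      by apply: le_trans (rnormD _ _) _; rewrite rnormN lerD// (le_trans bb').
    have := le_trans (rnormM _ _) (ler_pM (rnorm_ge0 _) (rnorm_ge0 _) aa' h2).
    lra.
  apply: le_trans (rnormB_tri _ (p (x * y)) _) _.
  have := mulB _ _ _ _ _ (ltW xc) (ltW yd) (lexx _) (lexx _).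
  rewrite -rmorphM/= => /(le_trans (qp _ _)).
  rewrite pM (rnormB (p x * p y)).
  have := mulB _ _ _ _ _ (le_trans (qp c x) (ltW xc))
    (le_trans (qp d y) (ltW yd)) (q_le c) (q_le d).
  lra.
pose qL := GRing.isLinear.Build R[i] C A *:%R q qlin.
pose f : {linear C -> A} := HB.pack q qL.
exists f; split => //= x; apply/eqP.
by rewrite -subr_eq0 -rnorm_le0 (le_trans (qp _ x))// subrr rnorm0.
Qed.

End extension.

(** * Slice maps on tensor products *)

Section tensor.
Context {R : realType}.

(** Both maps factor the same bilinear map, so the uniqueness in the universal property applies. *)
Lemma tensor_ext (A B T : comAlgType R[i]) (t : {bilinear A -> B -> T})
    (W : lmodType R[i]) (h1 h2 : {linear T -> W}) :
  is_tensor_product t -> (forall a b, h1 (t a b) = h2 (t a b)) -> h1 =1 h2.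
Proof.
move=> tP h12; pose f a b := h1 (t a b).
have fP : bilinear_for *:%R *:%R f.
  by split=> [b|a] k x y; rewrite /f ?linearPl ?linearPr linearP.
pose g : {bilinear A -> B -> W} :=
  HB.pack f (bilinear_isBilinear.Build R[i] A B W *:%R *:%R f fP).
have [h [_ hu]] := tensor_universal tP g.
by move=> x; rewrite (hu h1)// (hu h2)// => a b; rewrite -h12.
Qed.

Lemma tensor_slice (A B T : comAlgType R[i]) (t : {bilinear A -> B -> T})
    (psi : {scalar B}) :
  is_tensor_product t -> (forall b b', psi (b * b') = psi b * psi b') ->
  exists p : {linear T -> A}, (forall a b, p (t a b) = psi b *: a) /\
    forall x y, p (x * y) = p x * p y.
Proof.
move=> tP psiM; pose f a b := psi b *: a : A.
have fP : bilinear_for *:%R *:%R f.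
  split=> [b|a] k x y; rewrite /f/=.
    by rewrite scalerDr !scalerA mulrC.
  have -> : psi (k *: x + y) = k * psi x + psi y by exact: (linearP psi).
  by rewrite scalerDl scalerA.
pose g : {bilinear A -> B -> A} :=
  HB.pack f (bilinear_isBilinear.Build R[i] A B A *:%R *:%R f fP).
have [p [pt _]] := tensor_universal tP g.
have {}pt a b : p (t a b) = psi b *: a := pt a b.
exists p; split=> //.
have lin1 y : linear (fun x => p (x * y)).
  by move=> k u v; rewrite mulrDl -scalerAl linearP.
have lin2 y : linear (fun x => p x * p y).
  by move=> k u v; rewrite linearP mulrDl -scalerAl.
pose h1 y : {linear T -> A} :=
  HB.pack (fun x => p (x * y)) (GRing.isLinear.Build R[i] T A *:%R _ (lin1 y)).
pose h2 y : {linear T -> A} :=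
  HB.pack (fun x => p x * p y) (GRing.isLinear.Build R[i] T A *:%R _ (lin2 y)).
(* Multiplicativity is checked on elementary tensors one factor at a time; commutativity brings the
   free factor to the left. *)
have ptM a b y : p (t a b * y) = p (t a b) * p y.
  rewrite mulrC [RHS]mulrC; apply: (tensor_ext (h1 := h1 _) (h2 := h2 _) tP).
  move=> a' b'.
  by rewrite /= tensorM// !pt psiM -scalerAl -scalerAr scalerA.
move=> x y; apply: (tensor_ext (h1 := h1 y) (h2 := h2 y) tP) => a b.
exact: ptM.
Qed.

(** For a norming functional [f] of [p x], the composite [f \o p] is the functional of [f] and [psi]
    on the tensor product, a competitor in the supremum. *)
Lemma slice_le (A B : comBanachAlgType R[i]) (T : comAlgType R[i])
    (t : {bilinear A -> B -> T}) (psi : {scalar B}) (p : {linear T -> A}) x :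
  dual_ball psi -> (forall a b, p (t a b) = psi b *: a) ->
  ((rnorm (p x))%:E <= injective_norm t x)%E.
Proof.
move=> psi1 pt; have [f f1 fpx] := hahn_banach_norm (p x).
have glin : scalar (f \o p).
  by move=> k u v; rewrite /= linearP [LHS](linearP f).
pose g : {scalar T} :=
  HB.pack (f \o p) (GRing.isLinear.Build R[i] T R[i] *%R _ glin).
apply: (@le_trans _ _ (rnorm (g x : R[i]^o))%:E); first by rewrite lee_fin.
apply: ereal_sup_ubound; exists g => //; exists f => //; exists psi => // a b.
by rewrite /= pt mulrC; exact: (linearZ_LR f).
Qed.

Lemma tomiyama_strong_ditkinl (A B C : comBanachAlgType R[i]) :
  semisimple B -> is_tomiyama_product A B C -> strong_ditkin C ->
  strong_ditkin A.
Proof.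
move=> ssB [T [t [N [iota [tP _ _ N_ge [iotaN iota_dense]]]]]].
have [psi _] : exists psi : spectrum B, True.
  (* Without characters, 1 and 0 would have the same Gelfand transform. *)
  apply: contrapT => /forallNP noB; move/eqP: (oner_neq0 B); apply.
  by apply: ssB; apply/funext => psi; have := noB psi.
have [p [pt pM]] := tensor_slice tP (@spectrumM _ _ psi).
have p_le x : rnorm (p x) <= rnorm (iota x).
  rewrite iotaN -lee_fin; apply: le_trans (N_ge x).
  exact: slice_le (spectrum_dual_ball psi) pt.
have [q [qiota qM q_le]] := contraction_extension iota_dense pM p_le.
have [b b0] := spectrum_neq0 psi.
(* The factor [(psi b)^-1] makes the slice of the tensor equal to [a]. *)
apply: (strong_ditkin_retract
  (j := fun a => iota (t ((psi b)^-1 *: a) b)) qM _ q_le).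
by move=> a; rewrite qiota pt scalerA divff// scale1r.
Qed.

Lemma tomiyama_sym (A B C : comBanachAlgType R[i]) :
  is_tomiyama_product A B C -> is_tomiyama_product B A C.
Proof.
move=> [T [t [N [iota [tP NP Nt N_ge iotaC]]]]].
(* General modules, because both [t] and the test maps of the universal property get flipped. *)
have flipP (U V W : lmodType R[i]) (f : {bilinear U -> V -> W}) :
    bilinear_for *:%R *:%R (fun v u => f u v).
  by split=> [u|v] k x y; rewrite ?linearPl ?linearPr.
pose flip (U V W : lmodType R[i]) (f : {bilinear U -> V -> W}) :
    {bilinear V -> U -> W} := HB.pack (fun v u => f u v)
  (bilinear_isBilinear.Build R[i] V U W *:%R *:%R _ (flipP U V W f)).
exists T, (flip A B T t), N, iota; split=> //.
- split=> [W f|b b' a a'] /=; last exact: tensorM.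
  have [g [gt gu]] := tensor_universal tP (flip _ _ _ f).
  by exists g; split=> [b a|h ht]; [exact: gt|apply: gu => a b; exact: ht].
- by move=> b a; rewrite [LHS]Nt mulrC.
- move=> x; apply: le_trans (N_ge x).
  apply: le_ereal_sup => _ [g [psi psi1 [phi phi1 gE]] <-].
  by exists g => //; exists phi => //; exists psi => // a b; rewrite mulrC -gE.
Qed.

End tensor.

Theorem corollary3p4 (R : realType) (A B C : comBanachAlgType R[i])
    (ssA : semisimple A) (ssB : semisimple B)
    (tomC : is_tomiyama_product A B C) (ssC : semisimple C)
    (ditC : strong_ditkin C) :
  strong_ditkin A /\ strong_ditkin B.
Proof.
split; first exact: tomiyama_strong_ditkinl ssB tomC ditC.
exact: tomiyama_strong_ditkinl ssA (tomiyama_sym tomC) ditC.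
Qed.
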